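(* Let a finite group $\mathcal{G}$ act (on the right) on a finite set $\Omega$, with orbits $O_j$ of sizes $N_j$. For $\mathcal{B}\subseteq\Omega$, put $b_j=|\mathcal{B}\cap O_j|$ and $q_j=1-b_j/N_j$. For every integer $t\ge1$ there are $g_1,\dots,g_t\in\mathcal{G}$ such that $$\left|\bigcup_{i=1}^t\mathcal{B}g_i\right|\ge\left\lceil\sum_jN_j(1-q_j^t)\right\rceil.$$ They can be selected deterministically: if $U_r$ denotes the union $\bigcup_{i\le r}\mathcal{B}g_i$ after $r<t$ choices, choosing at each step $g_{r+1}\in\mathcal{G}$ to maximize $$\sum_jq_j^{\,t-r-1}\,\bigl|(\mathcal{B}g_{r+1}\setminus U_r)\cap O_j\bigr|$$ yields elements satisfying the displayed bound. Here $q_j^0=1$, including when $q_j=0$. *)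

(* Defs.v *)
From mathcomp Require Import all_boot all_order all_algebra all_fingroup.

Set Implicit Arguments.
Unset Strict Implicit.
Unset Printing Implicit Defensive.

Import Order.TTheory GRing.Theory Num.Theory.
Local Open Scope ring_scope.

Section OrbitCover.

Variables (gT : finGroupType) (G : {group gT}) (Omega : finType).
(* MathComp actions are right actions: to x (g * h) = to (to x g) h. *)
Variable to : action G Omega.

Definition orbits : {set {set Omega}} := [set orbit to G x | x in [set: Omega]].

Variable B : {set Omega}.

Definition miss (O : {set Omega}) : rat := 1 - #|B :&: O|%:R / #|O|%:R.

Variables (t : nat) (g : 'I_t -> gT).

(* The choices are numbered from 0, so r counts the choices made before g r, and
   partial_union r involves exactly the first r choices. *)
Definition partial_union (r : nat) : {set Omega} :=
  \bigcup_(i < t | (i < r)%N) setact to B (g i).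

(* The quantity to be maximized over h in G after r choices. *)
Definition gain (r : nat) (h : gT) : rat :=
  \sum_(O in orbits)
    miss O ^+ (t - r - 1)%N * #|(setact to B h :\: partial_union r) :&: O|%:R.

Definition greedy : Prop :=
  forall r : 'I_t,
    g r \in G /\ (forall h : gT, h \in G -> gain r h <= gain r (g r)).

End OrbitCover.

(* Main.v *)
(* Method of conditional expectations. For a uniform g in G, a point of an orbit O
   misses B g with probability q_O = 1 - |B :&: O| / |O|, so if n choices remain and
   U is covered, the expected uncovered size is Phi_n(U) = \sum_O q_O^n |O :\: U|.
   Averaging over g gives E[Phi_n(U :|: B g)] = Phi_{n+1}(U), and the greedy choice
   is the one minimizing Phi_n(U :|: B g), so Phi never increases along a greedy
   run. It starts at \sum_O q_O^t |O| and ends at the size of the uncovered set. *)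
Require Import Defs.
From mathcomp Require Import all_boot all_order all_algebra all_fingroup.

Set Implicit Arguments.
Unset Strict Implicit.
Unset Printing Implicit Defensive.

Import Order.TTheory GRing.Theory Num.Theory.
Local Open Scope ring_scope.

Section OrbitCover.

Variables (gT : finGroupType) (G : {group gT}) (Omega : finType).
Variable to : action G Omega.

(** The elements of [G] carrying [x] to [y] form a right coset of the stabilizer of [x]. *)
Lemma card_amove x y :
  y \in orbit to G x -> #|amove to G x y| = #|'C_G[x | to]%g|.
Proof. by case/orbitP=> a Ga <-; rewrite amove_act // card_rcoset. Qed.

Lemma card_setactI (B X : {set Omega}) h :
  #|setact to B h :&: X| = (\sum_(b in B) (to b h \in X))%N.
Proof.
rewrite -sum1_card.
rewrite (eq_bigl (fun y => (y \in setact to B h) && (y \in X))); last first.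
  by move=> y; rewrite inE.
rewrite big_mkcondr big_imset /=; last by move=> x y _ _; apply: act_inj.
by apply: eq_bigr => b _; case: ifP.
Qed.

(** Sort the [h] with [to x h \in X] by the value [to x h]: each fibre is a coset of the
    stabilizer. *)
Lemma card_transporter x (X : {set Omega}) : X \subset orbit to G x ->
  (\sum_(h in G) (to x h \in X) = #|X| * #|'C_G[x | to]%g|)%N.
Proof.
move=> sXO; rewrite (eq_bigr (fun h => if to x h \in X then 1 else 0)%N).
  rewrite -big_mkcondr (partition_big (to x) (mem X)) => [|h /andP[]//] /=.
  rewrite -sum_nat_const; apply: eq_bigr => y Xy.
  rewrite -(card_amove (subsetP sXO y Xy)) -sum1_card; apply: eq_bigl => h.
  by rewrite inE -andbA; case: eqP => [->|]; rewrite ?Xy ?andbF.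
by move=> h _; case: ifP.
Qed.

(** Double counting of the pairs [(b, h)] with [to b h \in X], then orbit-stabilizer. The factor
    [#|O|] keeps the identity free of division. *)
Lemma sum_card_setactI (B O X : {set Omega}) :
    O \in orbits to -> X \subset O ->
  (#|O| * \sum_(h in G) #|setact to B h :&: X| = #|G| * (#|B :&: O| * #|X|))%N.
Proof.
case/imsetP=> x _ defO sXO.
rewrite (eq_bigr _ (fun h _ => card_setactI B X h)) exchange_big /=.
(* Points [b] outside [O] contribute nothing, since [G] preserves [O]. *)
rewrite (bigID (mem O)) /= [X in (_ + X)%N]big1 ?addn0 => [|b /andP[_ O'b]].
  rewrite big_distrr mulnCA -sum_nat_const /=.
  apply: eq_big => [b|b /andP[_ Ob]]; first by rewrite inE.
  have defOb : O = orbit to G b.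
    by rewrite defO; apply/esym/orbit_in_eqP; rewrite // -defO.
  rewrite card_transporter -?defOb // mulnCA defOb.
  by rewrite card_orbit_in_stab // mulnC.
apply: big1 => h Gh; case: (boolP (_ \in X)) => // /(subsetP sXO).
by rewrite defO orbit_actr_in // -defO (negPf O'b).
Qed.

Lemma orbits_partition : partition (orbits to) setT.
Proof.
apply: orbit_partition; apply/subsetP => h Gh.
by rewrite !inE Gh; apply/subsetP => x; rewrite !inE.
Qed.

Variable B : {set Omega}.

(* The expected number of points left uncovered when [n] independent uniform
   translates of [B] are added to the covered set [U]. *)
Definition potential (n : nat) (U : {set Omega}) : rat :=
  \sum_(O in orbits to) miss B O ^+ n * #|O :\: U|%:R.

(** This is [gain] with the exponent and the covered set made independent of any run. *)
Definition decrease (n : nat) (U : {set Omega}) (h : gT) : rat :=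
  \sum_(O in orbits to) miss B O ^+ n * #|(setact to B h :\: U) :&: O|%:R.

Lemma potential_setU n U h :
  potential n (U :|: setact to B h) = potential n U - decrease n U h.
Proof.
rewrite -sumrB; apply: eq_bigr => O _; rewrite -mulrBr; congr (_ * _).
rewrite -setDDl -(cardsID (setact to B h) (O :\: U)) natrD.
have -> : (O :\: U) :&: setact to B h = (setact to B h :\: U) :&: O.
  by apply/setP=> x; rewrite !inE andbAC -!andbA andbC -!andbA; do !bool_congr.
by rewrite addrAC subrr add0r.
Qed.

(** On each orbit the translates of [B] cover on average a fraction [1 - miss B O] of [O :\: U], and
    [q^n * (1 - q) = q^n - q^n.+1]. *)
Lemma sum_decrease n U :
  \sum_(h in G) decrease n U h = #|G|%:R * (potential n U - potential n.+1 U).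
Proof.
rewrite exchange_big /= -sumrB mulr_sumr; apply: eq_bigr => O orbO.
have O_neq0 : #|O|%:R != 0 :> rat.
  case/imsetP: orbO => x _ ->; rewrite pnatr_eq0 -lt0n.
  by apply/card_gt0P; exists x; apply: orbit_refl.
rewrite -mulr_sumr exprSr -mulrA -mulrBr mulrCA; congr (_ * _).
apply: (mulfI O_neq0).
have := sum_card_setactI B orbO (subsetDl O U).
rewrite (eq_bigr (fun h => #|(setact to B h :\: U) :&: O|)) => [|h _]; last first.
  by rewrite setIDA -setIDAC.
move/(congr1 (fun k => k%:R : rat)); rewrite !natrM natr_sum => ->.
rewrite /miss mulrBl mul1r opprB addrC subrK [RHS]mulrCA; congr (_ * _).
by rewrite mulrA mulrCA divff ?mulr1.
Qed.

(* The maximal decrease is at least the average one. *)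
Lemma potential_greedy n U h : h \in G ->
    (forall k, k \in G -> decrease n U k <= decrease n U h) ->
  potential n (U :|: setact to B h) <= potential n.+1 U.
Proof.
move=> Gh max_h; rewrite potential_setU lerBlDl -lerBlDr.
have G_gt0 : 0 < #|G|%:R :> rat by rewrite ltr0n cardG_gt0.
rewrite -(ler_pM2l G_gt0) -sum_decrease mulr_natl -sumr_const.
exact: ler_sum.
Qed.

Variable t : nat.

Lemma partial_unionS (g : 'I_t -> gT) (r : 'I_t) :
  partial_union to B g r.+1 = partial_union to B g r :|: setact to B (g r).
Proof.
rewrite /partial_union (bigD1 r) //= setUC; congr (_ :|: _).
by apply: eq_bigl => i; rewrite ltnS [(i < r)%N]ltn_neqAle andbC.
Qed.

Lemma greedy_potential (g : 'I_t -> gT) r : greedy to B g -> (r <= t)%N ->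
  potential (t - r) (partial_union to B g r) <= potential t set0.
Proof.
move=> greedy_g; elim: r => [|r IHr] lt_rt.
  by rewrite subn0 /partial_union big_pred0.
apply: le_trans (IHr (ltnW lt_rt)).
have [Ggr max_gr] := greedy_g (Ordinal lt_rt).
(* Writing [t - r] as [(t - r.+1).+1] makes the exponent drop by one per choice; [t - r.+1] is the
   exponent in [gain]. *)
rewrite (partial_unionS g (Ordinal lt_rt)) -[in leRHS]subnSK //=.
apply: potential_greedy => // k Gk.
by have := max_gr k Gk; rewrite /gain -subnDA addn1.
Qed.

(** After [t] choices the exponent is 0, and [q^0 = 1] even for [q = 0], so the potential is exactly
    the number of uncovered points. *)
Lemma greedy_bound (g : 'I_t -> gT) : greedy to B g ->
  \sum_(O in orbits to) #|O|%:R * (1 - miss B O ^+ t)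
    <= #|\bigcup_(i < t) setact to B (g i)|%:R.
Proof.
move=> /greedy_potential/(_ (leqnn t)).
have -> : partial_union to B g t = \bigcup_(i < t) setact to B (g i).
  by apply: eq_bigl => i; rewrite ltn_ord.
set U := \bigcup_i _; rewrite subnn => le_pot.
have card_orbits (A : {set Omega}) :
      \sum_(O in orbits to) #|O :&: A|%:R = #|A|%:R :> rat.
  have [/eqP covT tiP _] := and3P orbits_partition.
  rewrite -natr_sum; congr _%:R; rewrite -[in RHS]sum1_card.
  rewrite (eq_bigl (fun x => (x \in cover (orbits to)) && (x \in A))); last first.
    by move=> x; rewrite covT inE.
  rewrite big_trivIset_cond //; apply: eq_bigr => O _.
  by rewrite -sum1_card; apply: eq_bigl => x; rewrite inE.
have pot0 : potential 0 U = #|~: U|%:R.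
  by rewrite -card_orbits; apply: eq_bigr => O _; rewrite mul1r setDE.
rewrite (eq_bigr (fun O => #|O :&: setT|%:R - miss B O ^+ t * #|O :\: set0|%:R)).
  rewrite sumrB card_orbits -/(potential t set0) lerBlDr.
  apply: le_trans (lerD (lexx _) le_pot); rewrite pot0 -natrD ler_nat.
  by rewrite cardsC cardsT.
by move=> O _; rewrite setIT setD0 mulrBr mulr1 [_ ^+ t * _]mulrC.
Qed.

(** The gain at step [r] depends only on the choices before [r], so resetting choice [n] to a
    maximizer leaves the earlier choices optimal. *)
Lemma greedy_exists : exists g : 'I_t -> gT, greedy to B g.
Proof.
suff greedy_upto n : exists g : 'I_t -> gT, forall r : 'I_t, (r < n)%N ->
    g r \in G /\ (forall h, h \in G -> gain to B g r h <= gain to B g r (g r)).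
  by have [g greedy_g] := greedy_upto t; exists g => r; apply: greedy_g.
elim: n => [|n [g greedy_g]]; first by exists (fun=> 1%g).
have [m Gm max_m] := arg_maxP (gain to B g n) (group1 G).
pose g' (i : 'I_t) := if i == n :> nat then m else g i.
have eq_gain (r : 'I_t) h : (r <= n)%N -> gain to B g' r h = gain to B g r h.
  move=> le_rn; rewrite /gain.
  suff -> : partial_union to B g' r = partial_union to B g r by [].
  apply: eq_bigr => i lt_ir; rewrite /g' ifN //.
  by rewrite neq_ltn (leq_trans lt_ir).
exists g' => r; rewrite ltnS => le_rn.
have -> : g' r = if r == n :> nat then m else g r by [].
case: eqP => [defr|/eqP ne_rn].
  by split=> // h Gh; rewrite !eq_gain // defr; apply: max_m.
have [|Ggr max_gr] := greedy_g r; first by rewrite ltn_neqAle ne_rn.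
by split=> // h Gh; rewrite !eq_gain //; apply: max_gr.
Qed.

End OrbitCover.

Theorem proposition8p2 (gT : finGroupType) (G : {group gT}) (Omega : finType)
    (to : action G Omega) (B : {set Omega}) (t : nat) (ht : (1 <= t)%N) :
  let bound : int :=
    Num.ceil (\sum_(O in orbits to) #|O|%:R * (1 - miss B O ^+ t)) in
  [/\ exists g : 'I_t -> gT,
        (forall i, g i \in G) /\
        bound <= #|\bigcup_(i < t) setact to B (g i)|%:Z,
      exists g : 'I_t -> gT, greedy to B g
    & forall g : 'I_t -> gT, greedy to B g ->
        bound <= #|\bigcup_(i < t) setact to B (g i)|%:Z].
Proof.
move=> bound.
have greedyP (g : 'I_t -> gT) : greedy to B g ->
    bound <= #|\bigcup_(i < t) setact to B (g i)|%:Z.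
  (* A cardinality is an integer, so bounding the rational sum also bounds its ceiling. *)
  by move=> greedy_g; rewrite ceil_le_int; apply: greedy_bound.
have [g greedy_g] := greedy_exists to B t.
split=> //; last by exists g.
exists g; split; last exact: greedyP.
by move=> i; case: (greedy_g i).
Qed.
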